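(* Every formula $A\in\Phi$ is $\mathsf{Int2GC{+}FS}$-provable if and only if $A$ is relationally valid.
   Context: $\Phi$ is the set of formulas built from a countably infinite set $\mathit{Var}$ of propositional variables with $\neg,\vee,\wedge,\to$ and the unary operators $\Diamond,\Box,\dot{\Diamond},\blacksquare$. $\mathsf{Int2GC{+}FS}$ is the smallest set of formulas of $\Phi$ that contains all instances (in the language $\Phi$) of theorems of intuitionistic propositional logic and all instances of (FS1) $\Diamond(A\to B)\to(\Box A\to\Diamond B)$ and (FS2) $\dot{\Diamond}(A\to B)\to(\blacksquare A\to\dot{\Diamond} B)$, and is closed under modus ponens and the four rules: from $A\to\blacksquare B$ infer $\Diamond A\to B$; from $\Diamond A\to B$ infer $A\to\blacksquare B$; from $A\to\Box B$ infer $\dot{\Diamond} A\to B$; from $\dot{\Diamond} A\to B$ infer $A\to\Box B$. Composition of relations: $x\,(R\circ S)\,y$ iff there is $z$ with $x\,R\,z$ and $z\,S\,y$. An $\mathsf{IK}$-frame is a triple $(X,\le,R)$ where $\le$ is a quasiorder (reflexive, transitive) on $X$ and $R$ is a binary relation on $X$ with $(R\circ{\le})\subseteq({\le}\circ R)$ and $({\ge}\circ R)\subseteq(R\circ{\ge})$. An $\mathsf{IK}^2$-model $(X,\le,R,\models)$ is an $\mathsf{IK}$-frame with a relation $\models$ from $X$ to $\mathit{Var}$ such that $x\models p$ and $x\le y$ imply $y\models p$, extended to all formulas of $\Phi$ by: $x\models A\wedge B$ iff $x\models A$ and $x\models B$; $x\models A\vee B$ iff $x\models A$ or $x\models B$;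 $x\models A\to B$ iff for all $y\ge x$, $y\models A$ implies $y\models B$; $x\models\neg A$ iff $y\models A$ for no $y\ge x$; $x\models\Diamond A$ iff there is $y$ with $x\,(R\circ{\ge})\,y$ and $y\models A$; $x\models\Box A$ iff for all $y$, $x\,({\le}\circ R)\,y$ implies $y\models A$; $x\models\dot{\Diamond} A$ iff there is $y$ with $y\,({\le}\circ R)\,x$ and $y\models A$; $x\models\blacksquare A$ iff for all $y$, $y\,(R\circ{\ge})\,x$ implies $y\models A$. A formula $A$ is relationally valid if $x\models A$ for every element $x$ of every $\mathsf{IK}^2$-model. *)

(* Defs.v *)
From Stdlib Require Import Relations.

Inductive form : Type :=
| Var  (p : nat)
| Neg  (A : form)
| Or   (A B : form)
| And  (A B : form)
| Imp  (A B : form)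
| Dia  (A : form)   (* \Diamond *)
| Box  (A : form)   (* \Box *)
| DDia (A : form)   (* \dot\Diamond, left adjoint of \Box *)
| BBox (A : form).  (* \blacksquare, right adjoint of \Diamond *)

Inductive pform : Type :=
| PVar (p : nat)
| PNeg (A : pform)
| POr  (A B : pform)
| PAnd (A B : pform)
| PImp (A B : pform).

(* The usual Hilbert calculus, with negation primitive. *)
Inductive Int_thm : pform -> Prop :=
| Int_K A B : Int_thm (PImp A (PImp B A))
| Int_S A B C :
    Int_thm (PImp (PImp A (PImp B C)) (PImp (PImp A B) (PImp A C)))
| Int_andl A B : Int_thm (PImp (PAnd A B) A)
| Int_andr A B : Int_thm (PImp (PAnd A B) B)
| Int_andi A B : Int_thm (PImp A (PImp B (PAnd A B)))
| Int_orl A B : Int_thm (PImp A (POr A B))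
| Int_orr A B : Int_thm (PImp B (POr A B))
| Int_ore A B C :
    Int_thm (PImp (PImp A C) (PImp (PImp B C) (PImp (POr A B) C)))
| Int_negi A B :
    Int_thm (PImp (PImp A B) (PImp (PImp A (PNeg B)) (PNeg A)))
| Int_nege A B : Int_thm (PImp (PNeg A) (PImp A B))
| Int_mp A B : Int_thm (PImp A B) -> Int_thm A -> Int_thm B.

Fixpoint inst (s : nat -> form) (A : pform) : form :=
  match A with
  | PVar p => s p
  | PNeg A => Neg (inst s A)
  | POr A B => Or (inst s A) (inst s B)
  | PAnd A B => And (inst s A) (inst s B)
  | PImp A B => Imp (inst s A) (inst s B)
  end.

Inductive Int2GC_FS : form -> Prop :=
| ax_int (A : pform) (s : nat -> form) : Int_thm A -> Int2GC_FS (inst s A)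
| ax_FS1 A B :
    Int2GC_FS (Imp (Dia (Imp A B)) (Imp (Box A) (Dia B)))
| ax_FS2 A B :
    Int2GC_FS (Imp (DDia (Imp A B)) (Imp (BBox A) (DDia B)))
| rule_mp A B : Int2GC_FS (Imp A B) -> Int2GC_FS A -> Int2GC_FS B
| rule_BBox_Dia A B : Int2GC_FS (Imp A (BBox B)) -> Int2GC_FS (Imp (Dia A) B)
| rule_Dia_BBox A B : Int2GC_FS (Imp (Dia A) B) -> Int2GC_FS (Imp A (BBox B))
| rule_Box_DDia A B : Int2GC_FS (Imp A (Box B)) -> Int2GC_FS (Imp (DDia A) B)
| rule_DDia_Box A B : Int2GC_FS (Imp (DDia A) B) -> Int2GC_FS (Imp A (Box B)).

(* Diagrammatic order: [R] first, then [S]. *)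
Definition rcomp {X : Type} (R S : relation X) : relation X :=
  fun x y => exists z, R x z /\ S z y.

Record IK_frame : Type := {
  world : Type;
  le : relation world;
  acc : relation world;
  le_preorder : preorder world le;
  acc_le : inclusion world (rcomp acc le) (rcomp le acc);
  ge_acc : inclusion world (rcomp (transp world le) acc)
                           (rcomp acc (transp world le))
}.

Definition ge (F : IK_frame) : relation (world F) := transp (world F) (le F).

Record IK2_model : Type := {
  frame : IK_frame;
  val : world frame -> nat -> Prop;
  val_mono : forall p x y, val x p -> le frame x y -> val y p
}.

Fixpoint sat (M : IK2_model) (x : world (frame M)) (A : form) : Prop :=
  match A with
  | Var p => val M x p
  | Neg A => forall y, le (frame M) x y -> ~ sat M y A
  | Or A B => sat M x A \/ sat M x B
  | And A B => sat M x A /\ sat M x B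
  | Imp A B => forall y, le (frame M) x y -> sat M y A -> sat M y B
  | Dia A => exists y, rcomp (acc (frame M)) (ge (frame M)) x y /\ sat M y A
  | Box A => forall y, rcomp (le (frame M)) (acc (frame M)) x y -> sat M y A
  | DDia A => exists y, rcomp (le (frame M)) (acc (frame M)) y x /\ sat M y A
  | BBox A => forall y, rcomp (acc (frame M)) (ge (frame M)) y x -> sat M y A
  end.

Definition relationally_valid (A : form) : Prop :=
  forall (M : IK2_model) (x : world (frame M)), sat M x A.

(* Main.v *)
Require Import Defs.
From Stdlib Require Import Relations Classical Lia Cantor.

(** Soundness is an induction on derivations.  Truth is persistent along the
    quasiorder, the axioms (FS1), (FS2) only ask to evaluate both premises at
    one and the same [acc]-neighbour, and the four rules say that [Dia] is left
    adjoint to [BBox] and [DDia] to [Box], which holds because each pair looks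
    along the same relation in opposite directions.

    Completeness is by a canonical model.  Its worlds are the proper prime
    theories, ordered by inclusion, with [P] related to [Q] when [Box A] in
    [P] implies [A] in [Q], and [A] in [Q] implies [Dia A] in [P].  By the
    adjunctions, this is the same as asking that [BBox A] in [Q] implies [A]
    in [P], and [A] in [P] implies [DDia A] in [Q] ([canonical_converse]).  So
    reversing the relation amounts to exchanging ([Dia], [Box]) with ([DDia],
    [BBox]), an exchange under which the logic is invariant, and every fact
    about the relation is needed for one of the two pairs only.  There are two
    such facts.

    - [canonical_predecessor]: if [Box A] in [P] implies [A] in [Q], then [P]
      can be enlarged to a prime theory related to [Q].  This yields the frame
      conditions and the truth lemma for the boxes; it rests on the theorem
      [(Dia A -> Box B) -> Box (A -> B)], a consequence of (FS2).

    - [canonical_successor]: if [Dia A] is in [P], then [P] is related to a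
      prime theory that contains [A].  This yields the truth lemma for the
      diamonds; it rests on [Box (A -> B) -> (Dia A -> Dia B)], a consequence
      of (FS1).

    In both, the prime theory comes from [prime_separation]: a theory disjoint
    from a nonempty set closed under disjunction extends to a prime theory
    that is still disjoint from it. *)

(** * Soundness *)

Section Soundness.

Variable M : IK2_model.

Local Notation "x <= y" := (le (frame M) x y).
Local Notation R := (acc (frame M)).

Lemma le_refl x : x <= x.
Proof. destruct (le_preorder (frame M)) as [Hr _]; apply Hr. Qed.

Lemma le_trans x y z : x <= y -> y <= z -> x <= z.
Proof. destruct (le_preorder (frame M)) as [_ Ht]; apply Ht. Qed.

(** The two frame conditions are what the diamonds need: [ge_acc] transports an
    [acc]-successor to a larger world, and [acc_le] an [acc]-predecessor. *)
Lemma sat_mono A : forall x y, x <= y -> sat M x A -> sat M y A.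
Proof.
  induction A as [p|A IHA|A IHA B IHB|A IHA B IHB|A IHA B IHB
                 |A IHA|A IHA|A IHA|A IHA]; simpl; intros x y Hxy H.
  - exact (val_mono M p x y H Hxy).
  - intros z Hz; apply H; exact (le_trans _ _ _ Hxy Hz).
  - destruct H as [H|H]; [left; exact (IHA _ _ Hxy H)|right; exact (IHB _ _ Hxy H)].
  - destruct H as [HA HB]; split; [exact (IHA _ _ Hxy HA)|exact (IHB _ _ Hxy HB)].
  - intros z Hz; apply H; exact (le_trans _ _ _ Hxy Hz).
  - destruct H as (w & (z & Hxz & Hzw) & Hw).
    destruct (ge_acc (frame M) y z) as (z' & Hyz' & Hz'z); [now exists x|].
    exists w; split; [|exact Hw].
    exists z'; split; [exact Hyz'|exact (le_trans _ _ _ Hzw Hz'z)].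
  - intros w (z & Hyz & Hzw); apply H.
    exists z; split; [exact (le_trans _ _ _ Hxy Hyz)|exact Hzw].
  - destruct H as (w & (z & Hwz & Hzx) & Hw).
    destruct (acc_le (frame M) z y) as (z' & Hzz' & Hz'y); [now exists x|].
    exists w; split; [|exact Hw].
    exists z'; split; [exact (le_trans _ _ _ Hwz Hzz')|exact Hz'y].
  - intros w (z & Hwz & Hyz); apply H.
    exists z; split; [exact Hwz|exact (le_trans _ _ _ Hxy Hyz)].
Qed.

(** Persistence carries truth from the witness up to the intermediate world. *)
Lemma sat_Dia x A : sat M x (Dia A) <-> exists y, R x y /\ sat M y A.
Proof.
  split.
  - intros (y & (z & Hxz & Hyz) & Hy).
    exists z; split; [exact Hxz|exact (sat_mono A _ _ Hyz Hy)].
  - intros (y & Hxy & Hy).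
    exists y; split; [exists y; split; [exact Hxy|apply le_refl]|exact Hy].
Qed.

Lemma sat_DDia x A : sat M x (DDia A) <-> exists y, R y x /\ sat M y A.
Proof.
  split.
  - intros (y & (z & Hyz & Hzx) & Hy).
    exists z; split; [exact Hzx|exact (sat_mono A _ _ Hyz Hy)].
  - intros (y & Hyx & Hy).
    exists y; split; [exists y; split; [apply le_refl|exact Hyx]|exact Hy].
Qed.

Lemma sat_Box_acc x y A : sat M x (Box A) -> R x y -> sat M y A.
Proof. intros H Hxy; apply H; exists x; split; [apply le_refl|exact Hxy]. Qed.

Lemma sat_BBox_acc x y A : sat M y (BBox A) -> R x y -> sat M x A.
Proof. intros H Hxy; apply H; exists y; split; [exact Hxy|apply le_refl]. Qed.

Lemma Int_thm_sound A (s : nat -> form) :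
  Int_thm A -> forall x, sat M x (inst s A).
Proof.
  intros H; induction H as [A B|A B C|A B|A B|A B|A B|A B|A B C|A B|A B
                           |A B _ IHAB _ IHA]; simpl; intros x.
  - intros y _ HA z Hyz _; exact (sat_mono _ _ _ Hyz HA).
  - intros y _ HABC z Hyz HAB t Hzt HA.
    apply (HABC t (le_trans _ _ _ Hyz Hzt) HA t (le_refl t)).
    exact (HAB t Hzt HA).
  - intros y _ [HA _]; exact HA.
  - intros y _ [_ HB]; exact HB.
  - intros y _ HA z Hyz HB; split; [exact (sat_mono _ _ _ Hyz HA)|exact HB].
  - intros y _ HA; left; exact HA.
  - intros y _ HB; right; exact HB.
  - intros y _ HAC z Hyz HBC t Hzt [HA|HB].
    + exact (HAC t (le_trans _ _ _ Hyz Hzt) HA).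
    + exact (HBC t Hzt HB).
  - intros y _ HAB z Hyz HAnB t Hzt HA.
    apply (HAnB t Hzt HA t (le_refl t)).
    exact (HAB t (le_trans _ _ _ Hyz Hzt) HA).
  - intros y _ HnA z Hyz HA; destruct (HnA z Hyz HA).
  - exact (IHAB x x (le_refl x) (IHA x)).
Qed.

End Soundness.

Lemma soundness A : Int2GC_FS A -> relationally_valid A.
Proof.
  intros H M; induction H as [A s HA|A B|A B|A B _ IHAB _ IHA
                             |A B _ IH|A B _ IH|A B _ IH|A B _ IH]; intros x.
  - exact (Int_thm_sound M A s HA x).
  - intros y _ Hd z Hyz Hb.
    apply (sat_mono M _ _ _ Hyz), sat_Dia in Hd; destruct Hd as (w & Hzw & Hw).
    apply sat_Dia; exists w; split; [exact Hzw|].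
    exact (Hw w (le_refl M w) (sat_Box_acc M _ _ _ Hb Hzw)).
  - intros y _ Hd z Hyz Hb.
    apply (sat_mono M _ _ _ Hyz), sat_DDia in Hd; destruct Hd as (w & Hwz & Hw).
    apply sat_DDia; exists w; split; [exact Hwz|].
    exact (Hw w (le_refl M w) (sat_BBox_acc M _ _ _ Hb Hwz)).
  - exact (IHAB x x (le_refl M x) (IHA x)).
  - intros y _ Hy; apply sat_Dia in Hy; destruct Hy as (z & Hyz & Hz).
    exact (sat_BBox_acc M _ _ _ (IH z z (le_refl M z) Hz) Hyz).
  - intros y _ Hy w (z & Hwz & Hyz).
    apply (IH w w (le_refl M w)), sat_Dia.
    exists z; split; [exact Hwz|exact (sat_mono M _ _ _ Hyz Hy)].
  - intros y _ Hy; apply sat_DDia in Hy; destruct Hy as (z & Hzy & Hz).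
    exact (sat_Box_acc M _ _ _ (IH z z (le_refl M z) Hz) Hzy).
  - intros y _ Hy w (z & Hyz & Hzw).
    apply (IH w w (le_refl M w)), sat_DDia.
    exists z; split; [exact Hzw|exact (sat_mono M _ _ _ Hyz Hy)].
Qed.

(** * Theories and the deduction theorem *)

Definition theory (T : form -> Prop) : Prop :=
  (forall A, Int2GC_FS A -> T A) /\ (forall A B, T (Imp A B) -> T A -> T B).

Definition incl (S T : form -> Prop) : Prop := forall A, S A -> T A.

Lemma theory_thm T A : theory T -> Int2GC_FS A -> T A.
Proof. intros [H _]; apply H. Qed.

Lemma theory_mp T A B : theory T -> T (Imp A B) -> T A -> T B.
Proof. intros [_ H]; apply H. Qed.

Lemma theory_provable : theory Int2GC_FS.
Proof. split; [auto|exact rule_mp]. Qed.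

Definition inst3 (A B C : form) (p : nat) : form :=
  match p with 0 => A | 1 => B | _ => C end.

Section Theories.

Variable T : form -> Prop.
Hypothesis HT : theory T.

Lemma T_K A B : T (Imp A (Imp B A)).
Proof.
  apply (theory_thm T _ HT).
  exact (ax_int _ (inst3 A B A) (Int_K (PVar 0) (PVar 1))).
Qed.

Lemma T_S A B C :
  T (Imp (Imp A (Imp B C)) (Imp (Imp A B) (Imp A C))).
Proof.
  apply (theory_thm T _ HT).
  exact (ax_int _ (inst3 A B C) (Int_S (PVar 0) (PVar 1) (PVar 2))).
Qed.

Lemma theory_and A B : T (And A B) <-> T A /\ T B.
Proof.
  split; [intros H; split|intros [HA HB]].
  - refine (theory_mp _ _ _ HT (theory_thm T _ HT _) H).
    exact (ax_int _ (inst3 A B A) (Int_andl (PVar 0) (PVar 1))).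
  - refine (theory_mp _ _ _ HT (theory_thm T _ HT _) H).
    exact (ax_int _ (inst3 A B A) (Int_andr (PVar 0) (PVar 1))).
  - refine (theory_mp _ _ _ HT (theory_mp _ _ _ HT (theory_thm T _ HT _) HA) HB).
    exact (ax_int _ (inst3 A B A) (Int_andi (PVar 0) (PVar 1))).
Qed.

Lemma theory_orl A B : T A -> T (Or A B).
Proof.
  refine (theory_mp _ _ _ HT (theory_thm T _ HT _)).
  exact (ax_int _ (inst3 A B A) (Int_orl (PVar 0) (PVar 1))).
Qed.

Lemma theory_orr A B : T B -> T (Or A B).
Proof.
  refine (theory_mp _ _ _ HT (theory_thm T _ HT _)).
  exact (ax_int _ (inst3 A B A) (Int_orr (PVar 0) (PVar 1))).
Qed.

Lemma theory_ore A B C : T (Imp A C) -> T (Imp B C) -> T (Imp (Or A B) C).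
Proof.
  intros HA HB.
  refine (theory_mp _ _ _ HT (theory_mp _ _ _ HT (theory_thm T _ HT _) HA) HB).
  exact (ax_int _ (inst3 A B C) (Int_ore (PVar 0) (PVar 1) (PVar 2))).
Qed.

Lemma theory_negi A B : T (Imp A B) -> T (Imp A (Neg B)) -> T (Neg A).
Proof.
  intros H1 H2.
  refine (theory_mp _ _ _ HT (theory_mp _ _ _ HT (theory_thm T _ HT _) H1) H2).
  exact (ax_int _ (inst3 A B A) (Int_negi (PVar 0) (PVar 1))).
Qed.

Lemma theory_nege A B : T (Neg A) -> T A -> T B.
Proof.
  intros H1 H2.
  refine (theory_mp _ _ _ HT (theory_mp _ _ _ HT (theory_thm T _ HT _) H1) H2).
  exact (ax_int _ (inst3 A B A) (Int_nege (PVar 0) (PVar 1))).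
Qed.

(** The theory generated by [T] and [A], in view of the next lemmas. *)
Definition extend (A : form) : form -> Prop := fun B => T (Imp A B).

Lemma extend_incl A : incl T (extend A).
Proof. intros B HB; exact (theory_mp _ _ _ HT (T_K B A) HB). Qed.

Lemma extend_mp A B C : extend A (Imp B C) -> extend A B -> extend A C.
Proof.
  intros H1 H2.
  exact (theory_mp _ _ _ HT (theory_mp _ _ _ HT (T_S A B C) H1) H2).
Qed.

Lemma theory_extend A : theory (extend A).
Proof.
  split; [|exact (extend_mp A)].
  intros B HB; apply extend_incl, (theory_thm T _ HT HB).
Qed.

Lemma extend_self A : extend A A.
Proof. exact (extend_mp A (Imp A A) A (T_K A (Imp A A)) (T_K A A)). Qed.

(** The deduction theorem in semantic form: an implication is introduced by
    moving to an arbitrary larger theory that contains its premise, so that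
    derivations become ordinary reasoning about membership. *)
Lemma imp_intro A B :
  (forall T', theory T' -> incl T T' -> T' A -> T' B) -> T (Imp A B).
Proof.
  intros H.
  exact (H (extend A) (theory_extend A) (extend_incl A) (extend_self A)).
Qed.

End Theories.

Lemma provable_imp A B :
  (forall T, theory T -> T A -> T B) -> Int2GC_FS (Imp A B).
Proof.
  intros H; apply (imp_intro _ theory_provable); intros T HT _; exact (H T HT).
Qed.

Lemma theory_imp T A B : theory T -> Int2GC_FS (Imp A B) -> T A -> T B.
Proof. intros HT H; exact (theory_mp _ _ _ HT (theory_thm T _ HT H)). Qed.

Lemma imp_trans A B C :
  Int2GC_FS (Imp A B) -> Int2GC_FS (Imp B C) -> Int2GC_FS (Imp A C).
Proof.
  intros H1 H2; apply provable_imp; intros T HT HA.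
  exact (theory_imp _ _ _ HT H2 (theory_imp _ _ _ HT H1 HA)).
Qed.

(** * Prime theories *)

Definition prime (P : form -> Prop) : Prop :=
  theory P /\ (forall A B, P (Or A B) -> P A \/ P B) /\ (exists A, ~ P A).

Lemma prime_theory P : prime P -> theory P.
Proof. intros [H _]; exact H. Qed.

Fixpoint code (A : form) : nat :=
  match A with
  | Var p => to_nat (0, p)
  | Neg A => to_nat (1, code A)
  | Or A B => to_nat (2, to_nat (code A, code B))
  | And A B => to_nat (3, to_nat (code A, code B))
  | Imp A B => to_nat (4, to_nat (code A, code B))
  | Dia A => to_nat (5, code A)
  | Box A => to_nat (6, code A)
  | DDia A => to_nat (7, code A)
  | BBox A => to_nat (8, code A)
  end.

Lemma code_inj A : forall B, code A = code B -> A = B.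
Proof.
  induction A; intros []; cbn [code]; intros H;
    apply to_nat_inj, pair_equal_spec in H as [Htag H]; try discriminate Htag;
    try apply to_nat_inj, pair_equal_spec in H as [H H'];
    f_equal; auto.
Qed.

Section Separation.

Variables T J : form -> Prop.
Hypothesis HT : theory T.
Hypothesis J_or : forall A B, J A -> J B -> J (Or A B).
Hypothesis J_inhabited : exists A, J A.
Hypothesis TJ : forall A, J A -> ~ T A.

(** Each formula is considered once, at the step of its code, so injectivity of
    the coding is all that the enumeration has to provide.  The disjunction
    avoids having to decide whether the extension meets [J]. *)
Fixpoint stage (n : nat) : form -> Prop :=
  match n with
  | 0 => T
  | S n => fun B => stage n B \/
      exists A, code A = n /\ (forall C, J C -> ~ extend (stage n) A C) /\
                extend (stage n) A B
  end.

Lemma stage_theory n : theory (stage n).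
Proof.
  induction n as [|n IH]; [exact HT|split].
  - intros A HA; left; exact (theory_thm _ _ IH HA).
  - intros B C [HBC|(A & HA & HJ & HBC)] [HB|(A' & HA' & HJ' & HB)].
    + left; exact (theory_mp _ _ _ IH HBC HB).
    + right; exists A'; repeat split; auto.
      exact (extend_mp _ IH _ _ _ (extend_incl _ IH A' _ HBC) HB).
    + right; exists A; repeat split; auto.
      exact (extend_mp _ IH _ _ _ HBC (extend_incl _ IH A _ HB)).
    + assert (A' = A) as -> by (apply code_inj; congruence).
      right; exists A; repeat split; auto.
      exact (extend_mp _ IH _ _ _ HBC HB).
Qed.

Lemma stage_mono m n : m <= n -> incl (stage m) (stage n).
Proof.
  intros H; induction H as [|n _ IH]; intros A HA; [exact HA|].
  left; exact (IH A HA).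
Qed.

Lemma stage_avoids n : forall A, J A -> ~ stage n A.
Proof.
  induction n as [|n IH]; [exact TJ|].
  intros B HB [H|(A & _ & HJ & H)]; [exact (IH B HB H)|exact (HJ B HB H)].
Qed.

Definition limit : form -> Prop := fun A => exists n, stage n A.

Lemma limit_theory : theory limit.
Proof.
  split.
  - intros A HA; exists 0; exact (theory_thm _ _ HT HA).
  - intros A B [m Hm] [n Hn]; exists (m + n).
    apply (theory_mp _ A B (stage_theory (m + n))).
    + apply (stage_mono m); [lia|exact Hm].
    + apply (stage_mono n); [lia|exact Hn].
Qed.

(** A formula left out was rejected at its own step. *)
Lemma limit_maximal A : ~ limit A -> exists C, J C /\ limit (Imp A C).
Proof.
  intros HA; apply NNPP; intros HC; apply HA.
  exists (S (code A)); right; exists A; repeat split.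
  - intros C HJ H; apply HC; exists C; split; [exact HJ|now exists (code A)].
  - exact (extend_self _ (stage_theory _) A).
Qed.

(** Maximality among the theories that avoid [J] makes the limit prime: if [A]
    and [B] are both left out, they imply members [C] and [D] of [J], so that
    [Or A B] implies [Or C D], which is in [J] again. *)
Lemma prime_separation :
  exists P, prime P /\ incl T P /\ (forall A, J A -> ~ P A).
Proof.
  assert (Havoid : forall A, J A -> ~ limit A).
  { intros A HA [n Hn]; exact (stage_avoids n A HA Hn). }
  exists limit; repeat split; try apply limit_theory; auto.
  - intros A B HAB.
    destruct (classic (limit A)) as [HA|HA]; [now left|].
    destruct (classic (limit B)) as [HB|HB]; [now right|].
    destruct (limit_maximal A HA) as (C & HC & HAC).
    destruct (limit_maximal B HB) as (D & HD & HBD).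
    destruct (Havoid (Or C D) (J_or C D HC HD)).
    refine (theory_mp _ _ _ limit_theory _ HAB).
    apply (theory_ore _ limit_theory);
      apply (imp_intro _ limit_theory); intros T' HT' Hincl H.
    + apply (theory_orl _ HT'); exact (theory_mp _ _ _ HT' (Hincl _ HAC) H).
    + apply (theory_orr _ HT'); exact (theory_mp _ _ _ HT' (Hincl _ HBD) H).
  - destruct J_inhabited as [A HA]; exists A; exact (Havoid A HA).
  - intros A HA; now exists 0.
Qed.

End Separation.

Lemma prime_separation1 T A :
  theory T -> ~ T A -> exists P, prime P /\ incl T P /\ ~ P A.
Proof.
  intros HT HA.
  assert (HAA : Int2GC_FS (Imp A A)) by (apply provable_imp; auto).
  (* The singleton of [A] is not closed under disjunction, but the set of
     formulas that imply [A] is. *)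
  destruct (prime_separation T (fun B => Int2GC_FS (Imp B A)) HT)
    as (P & HP & Hincl & HJ).
  - intros B C; exact (theory_ore _ theory_provable B C A).
  - exists A; exact HAA.
  - intros B HB H; exact (HA (theory_imp _ _ _ HT HB H)).
  - exists P; auto.
Qed.

Lemma prime_neg P A : prime P -> P A -> ~ P (Neg A).
Proof.
  intros (HT & _ & B & HB) HA HnA; exact (HB (theory_nege _ HT A B HnA HA)).
Qed.

Lemma prime_imp_separation P A B :
  prime P -> ~ P (Imp A B) ->
  exists Q, prime Q /\ incl P Q /\ Q A /\ ~ Q B.
Proof.
  intros [HT _] H.
  destruct (prime_separation1 (extend P A) B (theory_extend P HT A) H)
    as (Q & HQ & Hincl & HB).
  exists Q; split; [exact HQ|split; [|split; [|exact HB]]].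
  - intros C HC; apply Hincl, (extend_incl P HT A C HC).
  - apply Hincl, (extend_self P HT).
Qed.

Lemma prime_neg_separation P A :
  prime P -> ~ P (Neg A) -> exists Q, prime Q /\ incl P Q /\ Q A.
Proof.
  intros HP H.
  destruct (prime_imp_separation P A (Neg A) HP) as (Q & HQ & Hincl & HA & _).
  - intros HAn; apply H, (theory_negi P (prime_theory P HP) A A); [|exact HAn].
    exact (extend_self P (prime_theory P HP) A).
  - exists Q; auto.
Qed.

(** * Tense operators and the canonical relation *)

(** What the logic says about its two adjoint pairs of operators, abstractly so
    that it can be used for each of the two orders of the pairs. *)
Record tense (dia box ddia bbox : form -> form) : Prop := {
  tense_FS1 : forall A B,
    Int2GC_FS (Imp (dia (Imp A B)) (Imp (box A) (dia B)));
  tense_FS2 : forall A B,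
    Int2GC_FS (Imp (ddia (Imp A B)) (Imp (bbox A) (ddia B)));
  bbox_dia : forall A B,
    Int2GC_FS (Imp A (bbox B)) <-> Int2GC_FS (Imp (dia A) B);
  box_ddia : forall A B,
    Int2GC_FS (Imp A (box B)) <-> Int2GC_FS (Imp (ddia A) B)
}.

Lemma tense_forward : tense Dia Box DDia BBox.
Proof.
  split.
  - exact ax_FS1.
  - exact ax_FS2.
  - split; [apply rule_BBox_Dia|apply rule_Dia_BBox].
  - split; [apply rule_Box_DDia|apply rule_DDia_Box].
Qed.

Lemma tense_converse dia box ddia bbox :
  tense dia box ddia bbox -> tense ddia bbox dia box.
Proof. intros []; split; assumption. Qed.

Lemma tense_backward : tense DDia BBox Dia Box.
Proof. exact (tense_converse _ _ _ _ tense_forward). Qed.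

Definition canonical (dia box : form -> form) (P Q : form -> Prop) : Prop :=
  (forall A, P (box A) -> Q A) /\ (forall A, Q A -> P (dia A)).

Section Tense.

Variables dia box ddia bbox : form -> form.
Hypothesis H : tense dia box ddia bbox.

Lemma ddia_box_counit A : Int2GC_FS (Imp (ddia (box A)) A).
Proof. apply (box_ddia _ _ _ _ H), provable_imp; auto. Qed.

Lemma box_ddia_unit A : Int2GC_FS (Imp A (box (ddia A))).
Proof. apply (box_ddia _ _ _ _ H), provable_imp; auto. Qed.

Lemma dia_bbox_counit A : Int2GC_FS (Imp (dia (bbox A)) A).
Proof. apply (bbox_dia _ _ _ _ H), provable_imp; auto. Qed.

Lemma bbox_dia_unit A : Int2GC_FS (Imp A (bbox (dia A))).
Proof. apply (bbox_dia _ _ _ _ H), provable_imp; auto. Qed.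

Lemma dia_mono A B : Int2GC_FS (Imp A B) -> Int2GC_FS (Imp (dia A) (dia B)).
Proof.
  intros HAB; apply (bbox_dia _ _ _ _ H).
  exact (imp_trans _ _ _ HAB (bbox_dia_unit B)).
Qed.

Lemma box_mono A B : Int2GC_FS (Imp A B) -> Int2GC_FS (Imp (box A) (box B)).
Proof.
  intros HAB; apply (box_ddia _ _ _ _ H).
  exact (imp_trans _ _ _ (ddia_box_counit A) HAB).
Qed.

Lemma theory_dia_mono T A B :
  theory T -> Int2GC_FS (Imp A B) -> T (dia A) -> T (dia B).
Proof. intros HT HAB; exact (theory_imp _ _ _ HT (dia_mono A B HAB)). Qed.

Lemma theory_box_mono T A B :
  theory T -> Int2GC_FS (Imp A B) -> T (box A) -> T (box B).
Proof. intros HT HAB; exact (theory_imp _ _ _ HT (box_mono A B HAB)). Qed.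

Lemma theory_box_thm T A : theory T -> Int2GC_FS A -> T (box A).
Proof.
  intros HT HA; refine (theory_imp T A _ HT _ (theory_thm _ _ HT HA)).
  apply (box_ddia _ _ _ _ H), provable_imp.
  intros T' HT' _; exact (theory_thm _ _ HT' HA).
Qed.

(** Right adjoints preserve meets. *)
Lemma theory_box_and T A B :
  theory T -> T (box A) -> T (box B) -> T (box (And A B)).
Proof.
  intros HT HA HB.
  apply (theory_imp T (And (box A) (box B)) _ HT);
    [|now apply (theory_and T HT)].
  apply (box_ddia _ _ _ _ H), provable_imp; intros T' HT' HAB.
  apply (theory_and T' HT'); split.
  - refine (theory_imp T' _ _ HT' _ HAB); apply (box_ddia _ _ _ _ H).
    apply provable_imp; intros U HU HUAB; now apply (theory_and U HU) in HUAB.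
  - refine (theory_imp T' _ _ HT' _ HAB); apply (box_ddia _ _ _ _ H).
    apply provable_imp; intros U HU HUAB; now apply (theory_and U HU) in HUAB.
Qed.

Lemma theory_box_mp T A B :
  theory T -> T (box (Imp A B)) -> T (box A) -> T (box B).
Proof.
  intros HT HAB HA.
  refine (theory_box_mono T _ _ HT _ (theory_box_and T _ _ HT HAB HA)).
  apply provable_imp; intros U HU HU'; apply (theory_and U HU) in HU'.
  exact (theory_mp _ _ _ HU (proj1 HU') (proj2 HU')).
Qed.

Lemma theory_preimage_box T : theory T -> theory (fun A => T (box A)).
Proof.
  intros HT; split.
  - intros A HA; exact (theory_box_thm T A HT HA).
  - intros A B; exact (theory_box_mp T A B HT).
Qed.

(** Left adjoints preserve joins. *)
Lemma dia_or A B : Int2GC_FS (Imp (dia (Or A B)) (Or (dia A) (dia B))).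
Proof.
  apply (bbox_dia _ _ _ _ H), (theory_ore _ theory_provable);
    apply (bbox_dia _ _ _ _ H), provable_imp; intros T HT.
  - exact (theory_orl T HT _ _).
  - exact (theory_orr T HT _ _).
Qed.

Lemma dia_contradiction A B : Int2GC_FS (Imp (dia (And A (Neg A))) B).
Proof.
  apply (bbox_dia _ _ _ _ H), provable_imp; intros T HT HA.
  apply (theory_and T HT) in HA.
  exact (theory_nege T HT A _ (proj2 HA) (proj1 HA)).
Qed.

(** (FS1) at [A -> B] and [B], since [A] implies [(A -> B) -> B]. *)
Lemma theory_box_imp_dia T A B :
  theory T -> T (box (Imp A B)) -> T (dia A) -> T (dia B).
Proof.
  intros HT HAB HA; refine (theory_mp T _ _ HT _ HAB).
  apply (theory_imp T _ _ HT (tense_FS1 _ _ _ _ H (Imp A B) B)).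
  refine (theory_dia_mono T _ _ HT _ HA).
  apply provable_imp; intros U HU HUA; apply (imp_intro U HU).
  intros U' HU' Hincl HUAB; exact (theory_mp _ _ _ HU' HUAB (Hincl _ HUA)).
Qed.

(** After transposing [box], (FS2) turns the premise into
    [bbox (dia A) -> ddia (box B)], which implies [A -> B] by a unit and a
    counit. *)
Lemma dia_imp_box A B :
  Int2GC_FS (Imp (Imp (dia A) (box B)) (box (Imp A B))).
Proof.
  apply (box_ddia _ _ _ _ H), provable_imp; intros T HT Hd.
  apply (theory_imp T _ _ HT (tense_FS2 _ _ _ _ H (dia A) (box B))) in Hd.
  apply (imp_intro T HT); intros U HU Hincl HA.
  apply (theory_imp U _ _ HU (ddia_box_counit B)).
  apply (theory_mp U _ _ HU (Hincl _ Hd)).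
  exact (theory_imp U _ _ HU (bbox_dia_unit A) HA).
Qed.

Lemma canonical_converse P Q :
  theory P -> theory Q -> canonical dia box P Q -> canonical ddia bbox Q P.
Proof.
  intros HP HQ [Hbox Hdia]; split; intros A HA.
  - exact (theory_imp P _ _ HP (dia_bbox_counit A) (Hdia _ HA)).
  - exact (Hbox _ (theory_imp P _ _ HP (box_ddia_unit A) HA)).
Qed.

(** The enlarged [P] must contain [dia C] for [C] in [Q], and avoid [box B] for
    [B] outside [Q].  If [dia C -> box B] were in [P], then so would be
    [box (C -> B)], whence [C -> B] and [B] in [Q]. *)
Lemma canonical_predecessor P Q :
  theory P -> prime Q -> (forall A, P (box A) -> Q A) ->
  exists P', prime P' /\ incl P P' /\ canonical dia box P' Q.
Proof.
  intros HP (HQ & Qor & D & HD) Hbox.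
  destruct (prime_separation
    (fun B => exists C, Q C /\ P (Imp (dia C) B))
    (fun B => exists B', ~ Q B' /\ Int2GC_FS (Imp B (box B'))))
    as (P' & HP' & Hincl & HJ).
  - split.
    + intros A HA; exists (Imp D D); split.
      * apply (theory_thm _ _ HQ), provable_imp; auto.
      * apply (imp_intro P HP); intros U HU _ _; exact (theory_thm _ _ HU HA).
    + intros A B (C1 & HC1 & HAB) (C2 & HC2 & HA).
      exists (And C1 C2); split; [now apply (theory_and Q HQ)|].
      apply (imp_intro P HP); intros U HU HPU HC.
      apply (theory_mp U A B HU).
      * apply (theory_mp U _ _ HU (HPU _ HAB)).
        refine (theory_dia_mono U _ _ HU _ HC).
        apply provable_imp; intros V HV HV'; now apply (theory_and V HV) in HV'.
      * apply (theory_mp U _ _ HU (HPU _ HA)).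
        refine (theory_dia_mono U _ _ HU _ HC).
        apply provable_imp; intros V HV HV'; now apply (theory_and V HV) in HV'.
  - intros B1 B2 (B1' & HB1' & HB1) (B2' & HB2' & HB2).
    exists (Or B1' B2'); split.
    + intros HB; destruct (Qor _ _ HB); auto.
    + apply (theory_ore _ theory_provable).
      * apply (imp_trans _ _ _ HB1), box_mono, provable_imp.
        intros U HU; exact (theory_orl U HU _ _).
      * apply (imp_trans _ _ _ HB2), box_mono, provable_imp.
        intros U HU; exact (theory_orr U HU _ _).
  - exists (box D), D; split; [exact HD|apply provable_imp; auto].
  - intros B (B' & HB' & HB) (C & HC & HCB); apply HB'.
    refine (theory_mp Q C B' HQ _ HC).
    apply Hbox, (theory_imp P _ _ HP (dia_imp_box C B')).
    apply (imp_intro P HP); intros U HU HPU HUC.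
    apply (theory_imp U _ _ HU HB).
    exact (theory_mp U _ _ HU (HPU _ HCB) HUC).
  - exists P'; split; [exact HP'|split; [|split]].
    + intros A HA; apply Hincl; exists (Imp D D); split.
      * apply (theory_thm _ _ HQ), provable_imp; auto.
      * exact (extend_incl P HP _ A HA).
    + intros A HA; apply NNPP; intros HQA; refine (HJ (box A) _ HA).
      exists A; split; [exact HQA|apply provable_imp; auto].
    + intros A HA; apply Hincl; exists A; split; [exact HA|].
      exact (extend_self P HP (dia A)).
Qed.

(** The theory [Q] sought must contain [A] and each [B] with [box B] in [P],
    hence each [B] with [box (A -> B)] in [P], and avoid the [B] with [dia B]
    outside [P]. *)
Lemma canonical_successor P A :
  prime P -> P (dia A) -> exists Q, prime Q /\ canonical dia box P Q /\ Q A.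
Proof.
  intros (HP & Por & D & HD) HA.
  destruct (prime_separation
    (fun B => P (box (Imp A B))) (fun B => ~ P (dia B)))
    as (Q & HQ & Hincl & HJ).
  - split.
    + intros B HB; apply (theory_box_thm P _ HP), provable_imp.
      intros U HU _; exact (theory_thm _ _ HU HB).
    + intros B C HBC; refine (theory_box_mp P _ _ HP _).
      refine (theory_box_mono P _ _ HP _ HBC).
      exact (T_S _ theory_provable A B C).
  - intros B C HB HC HBC.
    apply (theory_imp P _ _ HP (dia_or B C)), Por in HBC as [|]; auto.
  - exists (And D (Neg D)); intros HDn.
    exact (HD (theory_imp P _ _ HP (dia_contradiction D D) HDn)).
  - intros B HB HAB; exact (HB (theory_box_imp_dia P A B HP HAB HA)).
  - exists Q; split; [exact HQ|split; [split|]].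
    + intros B HB; apply Hincl.
      exact (theory_box_mono P _ _ HP (T_K _ theory_provable B A) HB).
    + intros B HB; apply NNPP; intros HPB; exact (HJ B HPB HB).
    + apply Hincl, (theory_box_thm P _ HP), provable_imp; auto.
Qed.

Lemma canonical_box_witness P A :
  theory P -> ~ P (box A) ->
  exists P' Q, prime P' /\ prime Q /\
    incl P P' /\ canonical dia box P' Q /\ ~ Q A.
Proof.
  intros HP HA.
  destruct (prime_separation1 _ A (theory_preimage_box P HP) HA)
    as (Q & HQ & Hincl & HQA).
  destruct (canonical_predecessor P Q HP HQ Hincl) as (P' & HP' & HPP' & HR).
  exists P', Q; auto.
Qed.

End Tense.

(** * The canonical model *)

Definition prime_world : Type := { P : form -> Prop | prime P }.

Definition contains (P : prime_world) : form -> Prop := proj1_sig P.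

Lemma prime_contains (P : prime_world) : prime (contains P).
Proof. exact (proj2_sig P). Qed.

Lemma theory_contains (P : prime_world) : theory (contains P).
Proof. exact (prime_theory _ (prime_contains P)). Qed.

Definition canonical_le : relation prime_world :=
  fun P Q => incl (contains P) (contains Q).

Definition canonical_acc : relation prime_world :=
  fun P Q => canonical Dia Box (contains P) (contains Q).

Lemma canonical_acc_converse P Q :
  canonical_acc P Q <-> canonical DDia BBox (contains Q) (contains P).
Proof.
  split.
  - exact (canonical_converse _ _ _ _ tense_forward _ _
             (theory_contains P) (theory_contains Q)).
  - exact (canonical_converse _ _ _ _ tense_backward _ _
             (theory_contains Q) (theory_contains P)).
Qed.

Lemma canonical_le_preorder : preorder prime_world canonical_le.
Proof.
  split.
  - intros P A HA; exact HA.
  - intros P Q S HPQ HQS A HA; exact (HQS A (HPQ A HA)).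
Qed.

Lemma canonical_acc_le :
  inclusion prime_world (rcomp canonical_acc canonical_le)
                        (rcomp canonical_le canonical_acc).
Proof.
  intros P Q' (Q & [Hbox _] & HQ).
  destruct (canonical_predecessor _ _ _ _ tense_forward (contains P) (contains Q')
              (theory_contains P) (prime_contains Q'))
    as (P' & HP' & Hincl & HR); [intros A HA; exact (HQ A (Hbox A HA))|].
  exists (exist _ P' HP'); split; [exact Hincl|exact HR].
Qed.

Lemma canonical_ge_acc :
  inclusion prime_world (rcomp (transp _ canonical_le) canonical_acc)
                        (rcomp canonical_acc (transp _ canonical_le)).
Proof.
  intros P' Q (P & HP & HR); apply canonical_acc_converse in HR as [Hbbox _].
  destruct (canonical_predecessor _ _ _ _ tense_backward (contains Q) (contains P')
              (theory_contains Q) (prime_contains P'))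
    as (Q' & HQ' & Hincl & HR); [intros A HA; exact (HP A (Hbbox A HA))|].
  exists (exist _ Q' HQ'); split; [|exact Hincl].
  apply canonical_acc_converse; exact HR.
Qed.

Definition canonical_frame : IK_frame := {|
  world := prime_world;
  le := canonical_le;
  acc := canonical_acc;
  le_preorder := canonical_le_preorder;
  acc_le := canonical_acc_le;
  ge_acc := canonical_ge_acc
|}.

Definition canonical_model : IK2_model := {|
  frame := canonical_frame;
  val := fun P p => contains P (Var p);
  val_mono := fun p P Q HP HPQ => HPQ (Var p) HP
|}.

Lemma truth_lemma A :
  forall P : prime_world, sat canonical_model P A <-> contains P A.
Proof.
  induction A as [p|A IHA|A IHA B IHB|A IHA B IHB|A IHA B IHB
                 |A IHA|A IHA|A IHA|A IHA]; cbn [sat]; intros P;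
    pose proof (prime_contains P) as HP; pose proof (theory_contains P) as HT.
  - reflexivity.
  - split.
    + intros H; apply NNPP; intros HA.
      destruct (prime_neg_separation _ A HP HA) as (Q & HQ & Hincl & HQA).
      apply (H (exist _ Q HQ) Hincl), IHA; exact HQA.
    + intros H Q HPQ HA; apply IHA in HA.
      exact (prime_neg _ A (prime_contains Q) HA (HPQ _ H)).
  - rewrite IHA, IHB; split.
    + intros [HA|HB]; [exact (theory_orl _ HT A B HA)|exact (theory_orr _ HT A B HB)].
    + destruct HP as (_ & Por & _); apply Por.
  - rewrite IHA, IHB; symmetry; exact (theory_and _ HT A B).
  - split.
    + intros H; apply NNPP; intros HAB.
      destruct (prime_imp_separation _ A B HP HAB) as (Q & HQ & Hincl & HA & HB).
      apply HB, (IHB (exist _ Q HQ)), H; [exact Hincl|].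
      apply IHA; exact HA.
    + intros H Q HPQ HA; apply IHB; apply IHA in HA.
      exact (theory_mp _ _ _ (theory_contains Q) (HPQ _ H) HA).
  - split.
    + intros (Q & (S & [_ HR] & HQS) & HA).
      apply HR, HQS, IHA, HA.
    + intros HA.
      destruct (canonical_successor _ _ _ _ tense_forward _ A HP HA)
        as (Q & HQ & HR & HQA).
      exists (exist _ Q HQ); split; [|apply IHA; exact HQA].
      exists (exist _ Q HQ); split; [exact HR|intros B HB; exact HB].
  - split.
    + intros H; apply NNPP; intros HA.
      destruct (canonical_box_witness _ _ _ _ tense_forward _ A HT HA)
        as (P' & Q & HP' & HQ & Hincl & HR & HQA).
      apply HQA, (IHA (exist _ Q HQ)), H.
      exists (exist _ P' HP'); split; [exact Hincl|exact HR].
    + intros H Q (P' & HPP' & [HR _]); apply IHA, HR, HPP', H.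
  - split.
    + intros (Q & (S & HQS & HR) & HA).
      apply canonical_acc_converse in HR as [_ HR]; apply HR, HQS, IHA, HA.
    + intros HA.
      destruct (canonical_successor _ _ _ _ tense_backward _ A HP HA)
        as (Q & HQ & HR & HQA).
      exists (exist _ Q HQ); split; [|apply IHA; exact HQA].
      exists (exist _ Q HQ); split; [intros B HB; exact HB|].
      apply canonical_acc_converse; exact HR.
  - split.
    + intros H; apply NNPP; intros HA.
      destruct (canonical_box_witness _ _ _ _ tense_backward _ A HT HA)
        as (P' & Q & HP' & HQ & Hincl & HR & HQA).
      apply HQA, (IHA (exist _ Q HQ)), H.
      exists (exist _ P' HP'); split; [|exact Hincl].
      apply canonical_acc_converse; exact HR.
    + intros H Q (P' & HR & HPP').
      apply canonical_acc_converse in HR as [HR _]; apply IHA, HR, HPP', H.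
Qed.

Lemma completeness A : relationally_valid A -> Int2GC_FS A.
Proof.
  intros Hvalid; apply NNPP; intros HA.
  destruct (prime_separation1 _ A theory_provable HA) as (P & HP & _ & HPA).
  apply HPA, (truth_lemma A (exist _ P HP)), Hvalid.
Qed.

Theorem theorem4p10 (A : form) : Int2GC_FS A <-> relationally_valid A.
Proof. split; [apply soundness|apply completeness]. Qed.
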